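(* Let $A:\mathbb{R}\to M_{n\times n}(\mathbb{R})$, $K:\mathbb{R}\to M_{n\times m}(\mathbb{R})$, $C:\mathbb{R}\to M_{m\times n}(\mathbb{R})$ be continuous. Suppose $\dot x=A(t)x$ has non-uniform bounded growth with constants $K_0>0$, $a>0$, $\varepsilon>0$, and that there exist $\mathcal{K},\mathcal{C}>0$, $\delta>0$, $\gamma\ge0$ with $\|K(z)\|\le\mathcal{K}e^{-\delta|z|}$ and $\|C(z)\|\le\mathcal{C}e^{\gamma|z|}$ for all $z\in\mathbb{R}$, and $\delta>\gamma+\varepsilon$. Then the system $\dot x=A(t)x,\ y=C(t)x$ is non-uniformly completely observable (NUCO) if and only if the system $\dot x=(A(t)-K(t)C(t))x,\ y=C(t)x$ is NUCO.
   Context: For a continuous $V:\mathbb{R}\to M_{n\times n}(\mathbb{R})$, $\Phi_V(t,s)$ is the transition matrix of $\dot x=V(t)x$. Non-uniform bounded growth with constants $K_0>0,a>0,\eta>0$: $\|\Phi_V(t,\tau)\|\le K_0e^{\eta|\tau|}e^{a|t-\tau|}$ for all $t,\tau\in\mathbb{R}$. For the pair $(V,C)$ define the observability Gramians $M_V(a,b)=\int_a^b\Phi_V^T(s,a)C^T(s)C(s)\Phi_V(s,a)\,ds$ and $N_V(a,b)=\int_a^b\Phi_V^T(s,b)C^T(s)C(s)\Phi_V(s,b)\,ds$. The system $\dot x=V(t)x,\ y=C(t)x$ is non-uniformly completely observable (NUCO) on $\mathbb{R}$ if there exist constants $\nu_0,\nu_1,\bar\nu_0,\bar\nu_1\ge0$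 and functions $\vartheta_0,\varrho_0,\vartheta_1,\varrho_1:[0,\infty)\to(0,\infty)$ such that for every $t\in\mathbb{R}$ there is $\sigma_0(t)>0$ with $e^{-2\nu_0|t|}\vartheta_0(\sigma)I\le M_V(t,t+\sigma)\le e^{2\nu_1|t|}\vartheta_1(\sigma)I$ and $e^{-2\bar\nu_0|t|}\varrho_0(\sigma)I\le N_V(t,t+\sigma)\le e^{2\bar\nu_1|t|}\varrho_1(\sigma)I$ for every $\sigma\ge\sigma_0(t)$. Matrix inequalities are in the sense of the Loewner order on symmetric matrices. *)

(* Defs.v *)
From Stdlib Require Import Reals.
From Coquelicot Require Import Coquelicot.
From mathcomp Require Import all_boot all_order all_algebra.
From mathcomp Require Import Rstruct.
Set Implicit Arguments.
Unset Strict Implicit.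
Unset Printing Implicit Defensive.
Import Order.TTheory GRing.Theory Num.Theory.

Local Open Scope ring_scope.

Definition mx_continuous (p q : nat) (V : R -> 'M[R]_(p, q)) : Prop :=
  forall (i : 'I_p) (j : 'I_q) (t : R), Continuity.continuous (fun s => V s i j) t.

Definition is_transition_matrix (n : nat) (V : R -> 'M[R]_n)
  (Phi : R -> R -> 'M[R]_n) : Prop :=
  (forall s : R, Phi s s = 1%:M) /\
  (forall (t s : R) (i j : 'I_n),
      is_derive (fun u => Phi u s i j) t ((V t *m Phi t s) i j)).

Definition vnorm (n : nat) (x : 'cV[R]_n) : R :=
  sqrt (\sum_(i < n) (x i 0) ^+ 2).

Definition opnorm_le (p q : nat) (M : 'M[R]_(p, q)) (c : R) : Prop :=
  forall x : 'cV[R]_q, vnorm (M *m x) <= c * vnorm x.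

Definition nonuniform_bounded_growth (n : nat) (Phi : R -> R -> 'M[R]_n)
  (K0 a eta : R) : Prop :=
  forall t tau : R,
    opnorm_le (Phi t tau) (K0 * exp (eta * Rabs tau) * exp (a * Rabs (t - tau))).

Definition gramM (n m : nat) (Phi : R -> R -> 'M[R]_n) (C : R -> 'M[R]_(m, n))
  (a b : R) : 'M[R]_n :=
  \matrix_(i, j) RInt (fun s => (((Phi s a)^T *m (C s)^T *m C s *m Phi s a) i j)) a b.

Definition gramN (n m : nat) (Phi : R -> R -> 'M[R]_n) (C : R -> 'M[R]_(m, n))
  (a b : R) : 'M[R]_n :=
  \matrix_(i, j) RInt (fun s => (((Phi s b)^T *m (C s)^T *m C s *m Phi s b) i j)) a b.

Definition loewner_le (n : nat) (P Q : 'M[R]_n) : Prop :=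
  forall x : 'cV[R]_n, 0 <= (x^T *m (Q - P) *m x) 0 0.

(* Non-uniform complete observability of x' = V(t) x, y = C(t) x,
   where Phi is the transition matrix of V. Functions [0,oo) -> (0,oo)
   are represented as R -> R, positive on [0,oo). *)
Definition NUCO (n m : nat) (Phi : R -> R -> 'M[R]_n) (C : R -> 'M[R]_(m, n)) : Prop :=
  exists nu0 nu1 bnu0 bnu1 : R,
  0 <= nu0 /\ 0 <= nu1 /\ 0 <= bnu0 /\ 0 <= bnu1 /\
  exists theta0 rho0 theta1 rho1 : R -> R,
  (forall s : R, 0 <= s ->
     0 < theta0 s /\ 0 < rho0 s /\ 0 < theta1 s /\ 0 < rho1 s) /\
  forall t : R, exists sigma0 : R, 0 < sigma0 /\
    forall sigma : R, sigma0 <= sigma ->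
      loewner_le ((exp (- (2 * nu0 * Rabs t)) * theta0 sigma)%R%:M)
                 (gramM Phi C t (t + sigma)) /\
      loewner_le (gramM Phi C t (t + sigma))
                 ((exp (2 * nu1 * Rabs t) * theta1 sigma)%R%:M) /\
      loewner_le ((exp (- (2 * bnu0 * Rabs t)) * rho0 sigma)%R%:M)
                 (gramN Phi C t (t + sigma)) /\
      loewner_le (gramN Phi C t (t + sigma))
                 ((exp (2 * bnu1 * Rabs t) * rho1 sigma)%R%:M).

(* Main.v *)
(* Write [Psi] for the transition matrix of [A - K C].  Along [Psi], the scalar
   [u |-> xi^T Phi(s,u) Psi(u,tau) x] has derivative [- xi^T Phi(s,u) K(u) C(u) Psi(u,tau) x],
   so the two outputs satisfy a Volterra relation
   [|C(s) Phi(s,tau) x| <= |C(s) Psi(s,tau) x| + D \int |C(u) Psi(u,tau) x| du],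
   where [D] bounds [C(s) Phi(s,u) K(u)] on the window.  By Cauchy-Schwarz the Gramian of [Phi]
   is at most [2 + 2 D^2 sigma^2] times that of [Psi], and [D] grows like [exp (gamma |t|)];
   this transfers the lower bounds.  Gronwall's inequality gives [Psi] bounded growth with the
   same [K0] and [eps], which yields the upper bounds and lets the argument be run backwards
   with [- K] in place of [K]. *)
Require Import Defs.
From Stdlib Require Import Reals Lra.
From Coquelicot Require Import Coquelicot.
From mathcomp Require Import all_boot all_order all_algebra.
From mathcomp Require Import Rstruct.
Import Order.TTheory GRing.Theory Num.Theory.
Local Open Scope ring_scope.

(** * Scalar inequalities: mean-value bounds, Gronwall, Cauchy-Schwarz for integrals *)

Section RealAnalysis.
Local Open Scope R_scope.

Lemma derive_nonneg_le (f f' : R -> R) (a b : R) :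
  a <= b -> (forall u, is_derive f u (f' u)) ->
  (forall u, a <= u <= b -> 0 <= f' u) -> f a <= f b.
Proof.
intros ab df f'0.
destruct (MVT_gen f a b f') as [c [hc e]].
- intros; apply df.
- intros u _. apply continuity_pt_filterlim. apply: ex_derive_continuous.
  now exists (f' u).
- rewrite -> Rmin_left, Rmax_right in hc by lra.
  assert (h := f'0 c hc). nra.
Qed.

Lemma derive_nonpos_ge (f f' : R -> R) (a b : R) :
  a <= b -> (forall u, is_derive f u (f' u)) ->
  (forall u, a <= u <= b -> f' u <= 0) -> f b <= f a.
Proof.
intros ab df f'0.
apply Ropp_le_cancel.
apply (derive_nonneg_le (fun u => - f u) (fun u => - f' u)); auto.
- intros u. apply: is_derive_opp. apply df.
- intros u hu. specialize (f'0 u hu). lra.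
Qed.

Lemma ex_RInt_continuous_everywhere (q : R -> R) (a b : R) :
  (forall u, Continuity.continuous q u) -> ex_RInt q a b.
Proof. intros cq. apply: ex_RInt_continuous. intros; apply cq. Qed.

Lemma is_derive_RInt_continuous (q : R -> R) (a u : R) :
  (forall v, Continuity.continuous q v) -> is_derive (RInt q a) u (q u).
Proof.
intros cq. apply: (is_derive_RInt q (RInt q a) a u); last by apply cq.
apply filter_forall. intros v. apply: RInt_correct.
now apply ex_RInt_continuous_everywhere.
Qed.

(** Both [RInt q a u - p u] and [RInt q a u + p u] are nondecreasing in [u]. This route never
    integrates [p'], so no continuity of [p'] is required. *)
Lemma derive_abs_le_RInt_ordered (p p' q : R -> R) (a b : R) :
  a <= b -> (forall u, is_derive p u (p' u)) ->
  (forall u, Continuity.continuous q u) ->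
  (forall u, a <= u <= b -> Rabs (p' u) <= q u) ->
  Rabs (p b - p a) <= RInt q a b.
Proof.
intros ab dp cq le_pq.
assert (I0 : RInt q a a = 0) by apply: RInt_point.
assert (dQ := fun u => is_derive_RInt_continuous q a u cq).
assert (h1 : RInt q a a - p a <= RInt q a b - p b).
{ apply (derive_nonneg_le (fun u => RInt q a u - p u) (fun u => q u - p' u)); auto.
  - intros u. apply: is_derive_minus; [apply dQ | apply dp].
  - intros u hu. assert (h := Rle_abs (p' u)). specialize (le_pq u hu). lra. }
assert (h2 : RInt q a a + p a <= RInt q a b + p b).
{ apply (derive_nonneg_le (fun u => RInt q a u + p u) (fun u => q u + p' u)); auto.
  - intros u. apply: is_derive_plus; [apply dQ | apply dp].
  - intros u hu. assert (h := Rabs_maj2 (p' u)). specialize (le_pq u hu). lra. }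
apply Rabs_le. lra.
Qed.

(** The endpoints may come in either order because the base time of a transition matrix can lie on
    either side of the current time. *)
Lemma derive_abs_le_RInt (p p' q : R -> R) (a b : R) :
  (forall u, is_derive p u (p' u)) ->
  (forall u, Continuity.continuous q u) ->
  (forall u, Rmin a b <= u <= Rmax a b -> Rabs (p' u) <= q u) ->
  Rabs (p b - p a) <= Rabs (RInt q a b).
Proof.
intros dp cq le_pq.
destruct (Rle_dec a b) as [ab | ab].
- rewrite -> Rmin_left, Rmax_right in le_pq by lra.
  eapply Rle_trans; [|apply Rle_abs].
  now apply derive_abs_le_RInt_ordered with p'.
- rewrite -> Rmin_right, Rmax_left in le_pq by lra.
  rewrite Rabs_minus_sym -(opp_RInt_swap q b a); last now apply ex_RInt_continuous_everywhere.
  eapply Rle_trans; [|eapply Rle_trans; [apply Rle_abs|]].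
  + apply derive_abs_le_RInt_ordered with p'; try apply dp; try apply cq; try lra; auto.
  + right. rewrite /opp /= Rabs_Ropp. reflexivity.
Qed.

(** On each side of [t], the bound [B + c |RInt h t u|] times [exp (- c |u - t|)] does not increase
    as [u] moves away from [t]. At [u = t] the product is [B]. *)
Lemma gronwall (h : R -> R) (B c t : R) :
  0 <= c -> (forall s, Continuity.continuous h s) -> (forall s, 0 <= h s) ->
  (forall s, h s <= B + c * Rabs (RInt h t s)) ->
  forall s, h s <= B * exp (c * Rabs (s - t)).
Proof.
intros c0 ch h0 hh s.
assert (I0 : RInt h t t = 0) by apply: RInt_point.
assert (dI := fun u => is_derive_RInt_continuous h t u ch).
assert (exI : forall u, ex_derive (RInt h t) u) by (intros u; now exists (h u)).
assert (DI : forall u, Derive (fun x : R => RInt h t x) u = h u)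
  by (intros u; now apply is_derive_unique).
destruct (Rle_dec t s) as [ts | ts].
- assert (Ipos : forall u, t <= u -> 0 <= RInt h t u).
  { intros u tu. apply RInt_ge_0; auto. now apply ex_RInt_continuous_everywhere. }
  assert (le1 : exp (- c * s) * (B + c * RInt h t s)
                <= exp (- c * t) * (B + c * RInt h t t)).
  { apply (derive_nonpos_ge (fun u => exp (- c * u) * (B + c * RInt h t u))
      (fun u => exp (- c * u) * (c * (h u - (B + c * RInt h t u))))); auto.
    - intros u. move: (RInt h t) exI DI => I exI DI. auto_derive; [now apply exI|]. rewrite DI. ring.
    - intros u hu. specialize (hh u).
      rewrite Rabs_pos_eq in hh; last (apply Ipos; lra).
      assert (e0 := exp_pos (- c * u)).
      assert (c * (B + c * RInt h t u - h u) >= 0) by nra. nra. }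
  rewrite I0 in le1. specialize (hh s).
  rewrite Rabs_pos_eq in hh; last (apply Ipos; lra).
  rewrite Rabs_pos_eq; last lra.
  apply Rle_trans with (1 := hh).
  replace (c * (s - t)) with (c * s + - c * t) by ring.
  rewrite exp_plus.
  assert (E : exp (c * s) * exp (- c * s) = 1)
    by (rewrite -exp_plus; replace (c * s + - c * s) with 0 by ring; apply exp_0).
  assert (e0 := exp_pos (c * s)).
  replace (B + c * RInt h t s) with (exp (c * s) * (exp (- c * s) * (B + c * RInt h t s)));
    last (rewrite -Rmult_assoc E; ring).
  nra.
(* To the left of [t] the oriented integral is nonpositive, so its absolute value is its opposite
   and the integrating factor becomes [exp (c * u)]. *)
- assert (Ineg : forall u, u <= t -> RInt h t u <= 0).
  { intros u ut. rewrite -opp_RInt_swap; last now apply ex_RInt_continuous_everywhere.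
    assert (0 <= RInt h u t)
      by (apply RInt_ge_0; auto; now apply ex_RInt_continuous_everywhere).
    change (- RInt h u t <= 0). lra. }
  assert (le1 : exp (c * s) * (B - c * RInt h t s)
                <= exp (c * t) * (B - c * RInt h t t)).
  { apply (derive_nonneg_le (fun u => exp (c * u) * (B - c * RInt h t u))
      (fun u => exp (c * u) * (c * ((B - c * RInt h t u) - h u)))); try lra.
    - intros u. move: (RInt h t) exI DI => I exI DI. auto_derive; [now apply exI|]. rewrite DI. ring.
    - intros u hu. specialize (hh u).
      rewrite Rabs_left1 in hh; last (apply Ineg; lra).
      assert (e0 := exp_pos (c * u)).
      assert (c * (B - c * RInt h t u - h u) >= 0) by nra. nra. }
  rewrite I0 in le1. specialize (hh s).
  rewrite Rabs_left1 in hh; last (apply Ineg; lra).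
  rewrite Rabs_left1; last lra.
  apply Rle_trans with (1 := hh).
  replace (c * - (s - t)) with (- c * s + c * t) by ring.
  rewrite exp_plus.
  assert (E : exp (- c * s) * exp (c * s) = 1)
    by (rewrite -exp_plus; replace (- c * s + c * s) with 0 by ring; apply exp_0).
  assert (e0 := exp_pos (- c * s)).
  replace (B + c * - RInt h t s) with (exp (- c * s) * (exp (c * s) * (B - c * RInt h t s)));
    last (rewrite -Rmult_assoc E; ring).
  nra.
Qed.

(** The integral of [(f - k)^2] is nonnegative; taking for [k] the mean of [f] over the interval
    gives the claim. *)
Lemma RInt_cauchy_schwarz (f : R -> R) (a b : R) :
  a < b -> (forall u, Continuity.continuous f u) ->
  RInt f a b * RInt f a b <= (b - a) * RInt (fun u => f u * f u) a b.
Proof.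
intros ab cf.
assert (cff : forall u, Continuity.continuous (fun u => f u * f u) u)
  by (intros u; apply: continuous_mult; apply cf).
pose S : R := RInt f a b. pose J : R := RInt (fun u => f u * f u) a b.
change (S * S <= (b - a) * J).
pose k : R := S / (b - a).
assert (e : is_RInt (fun u => (f u * f u + - (2 * k) * f u) + k * k) a b
             ((J + - (2 * k) * S) + (b - a) * (k * k))).
{ apply: is_RInt_plus; last apply: is_RInt_const.
  apply: is_RInt_plus.
  - apply: RInt_correct. now apply ex_RInt_continuous_everywhere.
  - apply: is_RInt_scal. apply: RInt_correct. now apply ex_RInt_continuous_everywhere. }
assert (h : 0 <= (J + - (2 * k) * S) + (b - a) * (k * k)).
{ apply: (is_RInt_ge_0 _ a b _ _ e); first lra.
  intros u _. assert (h := Rle_0_sqr (f u - k)). unfold Rsqr in h. lra. }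
assert (kS : S = k * (b - a)) by (unfold k; field; lra).
rewrite kS in h |- *.
assert (b - a > 0) by lra. nra.
Qed.

End RealAnalysis.

Set Implicit Arguments.
Unset Strict Implicit.
Unset Printing Implicit Defensive.

(** * Entrywise differentiation and continuity of matrix-valued functions *)

Section MatrixCalculus.

Lemma is_derive_sum (I : Type) (r : seq I) (F : I -> R -> R) (D : I -> R) (t : R) :
  (forall i, is_derive (F i) t (D i)) ->
  is_derive (fun u => \sum_(i <- r) F i u) t (\sum_(i <- r) D i).
Proof.
move=> dF; elim: r => [|i r IHr].
  rewrite big_nil; apply: (is_derive_ext (fun _ : R => 0 : R)) => [u|]; first by rewrite big_nil.
  exact: is_derive_const.
rewrite big_cons.
apply: (is_derive_ext (fun u => F i u + \sum_(j <- r) F j u)) => [u|].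
  by rewrite big_cons.
exact: is_derive_plus.
Qed.

Lemma ex_derive_sum (I : Type) (r : seq I) (F : I -> R -> R) (t : R) :
  (forall i, ex_derive (F i) t) -> ex_derive (fun u => \sum_(i <- r) F i u) t.
Proof.
move=> dF; exists (\sum_(i <- r) Derive (F i) t); apply: is_derive_sum => i.
exact: Derive_correct.
Qed.

Lemma ex_derive_prod (I : Type) (r : seq I) (F : I -> R -> R) (t : R) :
  (forall i, ex_derive (F i) t) -> ex_derive (fun u => \prod_(i <- r) F i u) t.
Proof.
move=> dF; elim: r => [|i r IHr].
  apply: (ex_derive_ext (fun _ : R => 1 : R)) => [u|]; first by rewrite big_nil.
  exact: ex_derive_const.
apply: (ex_derive_ext (fun u => F i u * \prod_(j <- r) F j u)) => [u|].
  by rewrite big_cons.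
exact: ex_derive_mult.
Qed.

Lemma continuous_sum (I : Type) (r : seq I) (F : I -> R -> R) (t : R) :
  (forall i, Continuity.continuous (F i) t) ->
  Continuity.continuous (fun u => \sum_(i <- r) F i u) t.
Proof.
move=> cF; elim: r => [|i r IHr].
  apply: (continuous_ext (fun _ : R => 0 : R)) => [u|]; first by rewrite big_nil.
  exact: continuous_const.
apply: (continuous_ext (fun u => F i u + \sum_(j <- r) F j u)) => [u|].
  by rewrite big_cons.
exact: continuous_plus.
Qed.

Definition mx_is_derive (p q : nat) (X : R -> 'M[R]_(p, q)) (t : R) (D : 'M[R]_(p, q)) :=
  forall i j, is_derive (fun u => X u i j) t (D i j).

Definition mx_ex_derive (p q : nat) (X : R -> 'M[R]_(p, q)) (t : R) :=
  forall i j, ex_derive (fun u => X u i j) t.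

Lemma mx_is_derive_const (p q : nat) (X : 'M[R]_(p, q)) (t : R) :
  mx_is_derive (fun=> X) t 0.
Proof. by move=> i j; rewrite mxE; exact: is_derive_const. Qed.

Lemma mx_is_derive_sub (p q : nat) (X Y : R -> 'M[R]_(p, q)) (t : R) DX DY :
  mx_is_derive X t DX -> mx_is_derive Y t DY ->
  mx_is_derive (fun u => X u - Y u) t (DX - DY).
Proof.
move=> dX dY i j; rewrite !mxE.
apply: (is_derive_ext (fun u => X u i j - Y u i j)) => [u|]; first by rewrite !mxE.
exact: is_derive_minus.
Qed.

Lemma mx_is_derive_mul (p q r : nat) (X : R -> 'M[R]_(p, q)) (Y : R -> 'M[R]_(q, r))
    (t : R) DX DY :
  mx_is_derive X t DX -> mx_is_derive Y t DY ->
  mx_is_derive (fun u => X u *m Y u) t (DX *m Y t + X t *m DY).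
Proof.
move=> dX dY i j; rewrite !mxE -big_split /=.
apply: (is_derive_ext (fun u => \sum_k X u i k * Y u k j)) => [u|]; first by rewrite !mxE.
apply: is_derive_sum => k; apply: is_derive_mult; [exact: dX|exact: dY|].
by move=> x y; exact: mulrC.
Qed.

Lemma mx_is_derive_unique (p q : nat) (X : R -> 'M[R]_(p, q)) (t : R) D1 D2 :
  mx_is_derive X t D1 -> mx_is_derive X t D2 -> D1 = D2.
Proof.
move=> d1 d2; apply/matrixP => i j.
by have := is_derive_unique _ _ _ (d2 i j); rewrite (is_derive_unique _ _ _ (d1 i j)).
Qed.

Lemma mx_is_derive_continuous (p q : nat) (X D : R -> 'M[R]_(p, q)) :
  (forall t, mx_is_derive X t (D t)) -> mx_continuous X.
Proof. by move=> dX i j t; apply: ex_derive_continuous; exists (D t i j); exact: dX. Qed.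

Lemma mx_continuous_const (p q : nat) (X : 'M[R]_(p, q)) : mx_continuous (fun=> X).
Proof. by move=> i j t; exact: continuous_const. Qed.

Lemma mx_continuous_mul (p q r : nat) (X : R -> 'M[R]_(p, q)) (Y : R -> 'M[R]_(q, r)) :
  mx_continuous X -> mx_continuous Y -> mx_continuous (fun u => X u *m Y u).
Proof.
move=> cX cY i j t.
apply: (continuous_ext (fun u => \sum_k X u i k * Y u k j)) => [u|]; first by rewrite !mxE.
by apply: continuous_sum => k; apply: continuous_mult; [exact: cX|exact: cY].
Qed.

Lemma mx_continuous_sub (p q : nat) (X Y : R -> 'M[R]_(p, q)) :
  mx_continuous X -> mx_continuous Y -> mx_continuous (fun u => X u - Y u).
Proof.
move=> cX cY i j t.
apply: (continuous_ext (fun u => X u i j - Y u i j)) => [u|]; first by rewrite !mxE.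
by apply: continuous_minus; [exact: cX|exact: cY].
Qed.

Lemma mx_continuous_tr (p q : nat) (X : R -> 'M[R]_(p, q)) :
  mx_continuous X -> mx_continuous (fun u => (X u)^T).
Proof.
move=> cX i j t.
by apply: (continuous_ext (fun u => X u j i)) => [u|]; [rewrite !mxE | exact: cX].
Qed.

Lemma ex_derive_det (p : nat) (X : R -> 'M[R]_p) (t : R) :
  mx_ex_derive X t -> ex_derive (fun u => \det (X u)) t.
Proof.
move=> dX; apply: ex_derive_sum => s; apply: ex_derive_mult.
  exact: ex_derive_const.
by apply: ex_derive_prod => i; exact: dX.
Qed.

Lemma mx_ex_derive_adj (p : nat) (X : R -> 'M[R]_p) (t : R) :
  mx_ex_derive X t -> mx_ex_derive (fun u => \adj (X u)) t.
Proof.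
move=> dX i j.
apply: (ex_derive_ext (fun u => cofactor (X u) j i)) => [u|]; first by rewrite !mxE.
apply: ex_derive_mult; first exact: ex_derive_const.
apply: ex_derive_det => k l.
apply: (ex_derive_ext (fun u => X u (lift j k) (lift i l))) => [u|]; first by rewrite !mxE.
exact: dX.
Qed.

(** Cramer's rule writes [Y] as adjugate over determinant. Both are polynomial in the entries of
    [X], and the determinant never vanishes. *)
Lemma mx_ex_derive_inv (p : nat) (X Y : R -> 'M[R]_p) (t : R) :
  (forall u, Y u *m X u = 1%:M) -> mx_ex_derive X t -> mx_ex_derive Y t.
Proof.
move=> YX dX i j.
have detX u : \det (X u) != 0.
  by have [_ uX] := mulmx1_unit (YX u); rewrite -unitfE -unitmxE.
have YE u : Y u = (\det (X u))^-1 *: \adj (X u).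
  have [_ uX] := mulmx1_unit (YX u).
  by rewrite -[LHS](mulmxK uX) YX mul1mx /invmx uX.
apply: (ex_derive_ext (fun u => Rmult (Rinv (\det (X u))) ((\adj (X u)) i j))) => [u|].
  by rewrite YE [RHS]mxE.
apply: ex_derive_mult; last exact: mx_ex_derive_adj.
apply: ex_derive_inv; first exact: ex_derive_det.
exact/eqP.
Qed.

End MatrixCalculus.

(** * Inner product and Euclidean norm on column vectors *)

Section EuclideanNorm.

Definition dotv (n : nat) (x y : 'cV[R]_n) : R := (x^T *m y) 0 0.

Local Open Scope R_scope.

Lemma dotvE (n : nat) (x y : 'cV[R]_n) : dotv x y = (\sum_i x i ord0 * y i ord0)%R.
Proof. by rewrite /dotv mxE; apply: eq_bigr => i _; rewrite mxE. Qed.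

Lemma dotvC (n : nat) (x y : 'cV[R]_n) : dotv x y = dotv y x.
Proof. by rewrite !dotvE; apply: eq_bigr => i _; rewrite mulrC. Qed.

Lemma dotvDr (n : nat) (x y z : 'cV[R]_n) : dotv x (y + z)%R = dotv x y + dotv x z.
Proof. by rewrite /dotv mulmxDr mxE. Qed.

Lemma dotvNr (n : nat) (x y : 'cV[R]_n) : dotv x (- y)%R = - dotv x y.
Proof. by rewrite /dotv mulmxN mxE. Qed.

Lemma dotvBr (n : nat) (x y z : 'cV[R]_n) : dotv x (y - z)%R = dotv x y - dotv x z.
Proof. by rewrite dotvDr dotvNr. Qed.

Lemma dotvZr (n : nat) (c : R) (x y : 'cV[R]_n) : dotv x (c *: y)%R = c * dotv x y.
Proof. by rewrite /dotv -scalemxAr mxE. Qed.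

Lemma dotv_mulmx (p q : nat) (M : 'M[R]_(p, q)) (x : 'cV[R]_p) (y : 'cV[R]_q) :
  dotv x (M *m y) = dotv (M^T *m x) y.
Proof. by rewrite /dotv trmx_mul trmxK mulmxA. Qed.

Lemma dotv_ge0 (n : nat) (x : 'cV[R]_n) : 0 <= dotv x x.
Proof.
by rewrite dotvE; apply/RleP; apply: sumr_ge0 => i _; rewrite -expr2 sqr_ge0.
Qed.

Lemma vnorm_ge0 (n : nat) (x : 'cV[R]_n) : 0 <= vnorm x.
Proof. exact: sqrt_pos. Qed.

Lemma vnormE (n : nat) (x : 'cV[R]_n) : vnorm x = sqrt (dotv x x).
Proof. by rewrite dotvE. Qed.

Lemma vnorm_sqr (n : nat) (x : 'cV[R]_n) : vnorm x * vnorm x = dotv x x.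
Proof. by rewrite vnormE sqrt_sqrt //; exact: dotv_ge0. Qed.

Lemma coord_le_vnorm (n : nat) (x : 'cV[R]_n) (i : 'I_n) : Rabs (x i ord0) <= vnorm x.
Proof.
rewrite -[Rabs _](sqrt_square _ (Rabs_pos _)) vnormE; apply: sqrt_le_1_alt.
rewrite -Rabs_mult Rabs_pos_eq; last exact: Rle_0_sqr.
rewrite dotvE; apply/RleP; rewrite (bigD1 i) //= -RmultE lerDl.
by apply: sumr_ge0 => j _; rewrite -expr2 sqr_ge0.
Qed.

Lemma vnorm_le0_eq0 (n : nat) (x : 'cV[R]_n) : vnorm x <= 0 -> x = 0%R.
Proof.
move=> x0; apply/matrixP => i j; rewrite ord1 mxE.
have h := coord_le_vnorm x i; have h' := Rabs_pos (x i ord0).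
have h0 : Rabs (x i ord0) = 0 by lra.
case: (Req_dec (x i ord0) 0) => // hn.
by case: (Rabs_no_R0 _ hn).
Qed.

Lemma dotv_cauchy_schwarz (n : nat) (x y : 'cV[R]_n) :
  Rabs (dotv x y) <= vnorm x * vnorm y.
Proof.
have x0 := vnorm_ge0 x; have y0 := vnorm_ge0 y.
(* The zero vector is treated apart because the main case cancels the factor [N * N], the squared
   norm of [x]. *)
case: (Rle_lt_dec (vnorm x) 0) => hx.
  rewrite (vnorm_le0_eq0 hx) dotvC -{1}(scale0r (0 : 'cV[R]_n)%R) dotvZr.
  rewrite (_ : (0%R : R) = 0) // Rmult_0_l Rabs_R0.
  by apply: Rmult_le_pos => //; exact: vnorm_ge0.
pose k := dotv x y.
(* This vector is [|x|^2] times the component of [y] orthogonal to [x]; its squared norm is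
   [N^2 (N^2 P^2 - k^2)]. *)
have h := dotv_ge0 (dotv x x *: y - k *: x)%R.
rewrite dotvBr !dotvZr !(dotvC (_ - _)%R) !dotvBr !dotvZr (dotvC y x) -!vnorm_sqr -/k in h.
set N := vnorm x in x0 hx h *; set P := vnorm y in y0 h *.
have N2 : 0 < N * N by nra.
have h1 : 0 <= (N * N) * ((N * P) * (N * P) - k * k) by nra.
have h2 : k * k <= (N * P) * (N * P).
  case: (Rle_lt_dec (k * k) ((N * P) * (N * P))) => // h3; nra.
rewrite -(Rabs_pos_eq (N * P)); last by apply: Rmult_le_pos.
exact: Rsqr_le_abs_0.
Qed.

(** Choosing [xi = v] suffices. The lemma reduces vector estimates to scalar functions of time, to
    which the mean-value bounds apply. *)
Lemma vnorm_le_dual (n : nat) (v : 'cV[R]_n) (k : R) :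
  0 <= k -> (forall xi, Rabs (dotv xi v) <= vnorm xi * k) -> vnorm v <= k.
Proof.
move=> k0 h; have := h v; rewrite -vnorm_sqr Rabs_pos_eq; last exact: Rle_0_sqr.
have v0 := vnorm_ge0 v; move=> h1.
case: (Rle_lt_dec (vnorm v) k) => // h3; nra.
Qed.

Lemma vnorm_triangle (n : nat) (x y : 'cV[R]_n) : vnorm (x + y)%R <= vnorm x + vnorm y.
Proof.
apply: vnorm_le_dual => [|xi].
  by apply: Rplus_le_le_0_compat; exact: vnorm_ge0.
rewrite dotvDr; apply: Rle_trans (Rabs_triang _ _) _.
have := dotv_cauchy_schwarz xi x; have := dotv_cauchy_schwarz xi y; lra.
Qed.

Lemma continuous_vnorm (n : nat) (x : R -> 'cV[R]_n) (t : R) :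
  mx_continuous x -> Continuity.continuous (fun u => vnorm (x u)) t.
Proof.
move=> cx; apply: continuous_comp; last exact: continuous_sqrt.
by apply: continuous_sum => i; apply: continuous_mult; exact: cx.
Qed.

End EuclideanNorm.

(** * Linear differential equations: uniqueness, transition matrices, variation of constants *)

Section LinearODE.

Lemma is_derive_dotv (n : nat) (x y : R -> 'cV[R]_n) (t : R) (Dx Dy : 'cV[R]_n) :
  mx_is_derive x t Dx -> mx_is_derive y t Dy ->
  is_derive (fun u => dotv (x u) (y u)) t (dotv Dx (y t) + dotv (x t) Dy).
Proof.
move=> dx dy.
have dxT : mx_is_derive (fun u => (x u)^T) t Dx^T.
  move=> i j; rewrite mxE; apply: (is_derive_ext (fun u => x u j i)) => [u|].
    by rewrite mxE.
  exact: dx.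
by have := mx_is_derive_mul dxT dy 0 0; rewrite mxE.
Qed.

Lemma continuous_dotv (n : nat) (x y : R -> 'cV[R]_n) (t : R) :
  mx_continuous x -> mx_continuous y -> Continuity.continuous (fun u => dotv (x u) (y u)) t.
Proof.
by move=> cx cy; have := mx_continuous_mul (mx_continuous_tr cx) cy; move=> /(_ 0 0 t).
Qed.

(** The sum of absolute entries is a crude substitute for the operator norm, chosen because its
    continuity in time is immediate from that of the entries. *)
Lemma dotv_mulmx_le (n : nat) (V : 'M[R]_n) (x : 'cV[R]_n) :
  Rle (Rabs (dotv x (V *m x))) (Rmult (\sum_i \sum_j Rabs (V i j)) (dotv x x)).
Proof.
rewrite -vnorm_sqr dotvE; apply/RleP.
rewrite !RmultE mulr_suml RabsE; apply: le_trans (ler_norm_sum _ _ _) _.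
apply: ler_sum => i _; rewrite mxE mulr_sumr mulr_suml.
apply: le_trans (ler_norm_sum _ _ _) _; apply: ler_sum => j _.
rewrite mulrCA !normrM -!RabsE; apply: ler_wpM2l; first by apply/RleP; exact: Rabs_pos.
by apply: ler_pM; apply/RleP; [exact: Rabs_pos.. | exact: coord_le_vnorm | exact: coord_le_vnorm].
Qed.

Section Uniqueness.
Local Open Scope R_scope.

(** The energy [E = |x|^2] satisfies [|E'| <= 2 k E] between [t] and [s], where [k] bounds the entry
    sum of [V] there. Hence [exp (- 2 k u) * E u] is nonincreasing and [exp (2 k u) * E u]
    nondecreasing, and [E t = 0] forces [E s <= 0] in either direction. *)
Lemma linear_ode_zero (n : nat) (V : R -> 'M[R]_n) (x : R -> 'cV[R]_n) (t : R) :
  mx_continuous V -> (forall u, mx_is_derive x u (V u *m x u)) -> x t = 0%R ->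
  forall s, x s = 0%R.
Proof.
move=> cV dx xt0 s.
pose E u := dotv (x u) (x u).
pose L u : R := (\sum_i \sum_j Rabs (V u i j))%R.
have dE u : is_derive E u (2 * dotv (x u) (V u *m x u)).
  have := is_derive_dotv (dx u) (dx u).
  by rewrite dotvC -RplusE (_ : 2 * _ = dotv (x u) (V u *m x u) + dotv (x u) (V u *m x u)) //; ring.
have cL u : Continuity.continuous L u.
  apply: continuous_sum => i; apply: continuous_sum => j.
  by apply: continuous_comp; [exact: cV | exact: continuous_Rabs].
have [k hk] : exists k, forall u, Rmin t s <= u <= Rmax t s -> L u <= k.
  have [||w [hw _]] := continuity_ab_maj L (Rmin t s) (Rmax t s).
  - exact: Rminmax.
  - by move=> u _; apply/continuity_pt_filterlim; exact: cL.
  - by exists (L w).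
have bnd u : Rmin t s <= u <= Rmax t s -> Rabs (dotv (x u) (V u *m x u)) <= k * E u.
  move=> hu; apply: Rle_trans (dotv_mulmx_le _ _) _.
  by apply: Rmult_le_compat_r; [exact: dotv_ge0 | exact: hk].
have Et : E t = 0 by rewrite /E xt0 /dotv mulmx0 mxE.
have exE u : ex_derive E u by eexists; exact: dE.
have DE u : Derive (fun v => E v) u = 2 * dotv (x u) (V u *m x u) by exact: is_derive_unique.
have Es : E s <= 0.
  case: (Rle_dec t s) => ts.
    rewrite Rmin_left // Rmax_right // in bnd.
    have h : exp (- (2 * k) * s) * E s <= exp (- (2 * k) * t) * E t.
      apply: (derive_nonpos_ge (fun u => exp (- (2 * k) * u) * E u)
        (fun u => exp (- (2 * k) * u) * (2 * (dotv (x u) (V u *m x u) - k * E u)))) => // u.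
        by auto_derive; [exact: exE | rewrite DE; ring].
      move=> hu; have := bnd u hu; have := exp_pos (- (2 * k) * u).
      have := Rle_abs (dotv (x u) (V u *m x u)); nra.
    rewrite Et Rmult_0_r in h; have := exp_pos (- (2 * k) * s); nra.
  have st : s <= t by lra.
  rewrite Rmin_right // Rmax_left // in bnd.
  have h : exp (2 * k * s) * E s <= exp (2 * k * t) * E t.
    apply: (derive_nonneg_le (fun u => exp (2 * k * u) * E u)
      (fun u => exp (2 * k * u) * (2 * (dotv (x u) (V u *m x u) + k * E u)))) => // u.
      by auto_derive; [exact: exE | rewrite DE; ring].
    move=> hu; have := bnd u hu; have := exp_pos (2 * k * u).
    have := Rabs_maj2 (dotv (x u) (V u *m x u)); nra.
  rewrite Et Rmult_0_r in h; have := exp_pos (2 * k * s); nra.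
apply: vnorm_le0_eq0; have := vnorm_sqr (x s); have := vnorm_ge0 (x s).
rewrite -/(E s) => h0 h1; nra.
Qed.

End Uniqueness.

(** Each column of [X - Y] solves the vector equation and vanishes at [t]. *)
Lemma linear_ode_unique (n p : nat) (V : R -> 'M[R]_n) (X Y : R -> 'M[R]_(n, p)) (t : R) :
  mx_continuous V ->
  (forall u, mx_is_derive X u (V u *m X u)) -> (forall u, mx_is_derive Y u (V u *m Y u)) ->
  X t = Y t -> forall s, X s = Y s.
Proof.
move=> cV dX dY XY s; apply/matrixP => i j.
have h : col j (X s - Y s) = 0.
  apply: (@linear_ode_zero _ V (fun u => col j (X u - Y u)) t cV) => [u k l|].
    rewrite colE mulmxA -colE mulmxBr [X in is_derive _ _ X]mxE.
    apply: (is_derive_ext (fun v => (X v - Y v) k j)) => [v|]; first by rewrite [RHS]mxE.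
    exact: mx_is_derive_sub.
  by rewrite XY subrr; apply/matrixP => k l; rewrite !mxE.
by move/matrixP/(_ i 0): h; rewrite !mxE => /eqP; rewrite subr_eq0 => /eqP.
Qed.

Section Transition.

Variables (n : nat) (V : R -> 'M[R]_n) (Phi : R -> R -> 'M[R]_n).
Hypotheses (cV : mx_continuous V) (tPhi : is_transition_matrix V Phi).

Lemma mx_is_derive_transition (t s : R) :
  mx_is_derive (fun u => Phi u s) t (V t *m Phi t s).
Proof. by move=> i j; exact: (proj2 tPhi). Qed.

Lemma mx_continuous_transition (s : R) : mx_continuous (fun u => Phi u s).
Proof. exact: (mx_is_derive_continuous (fun t => mx_is_derive_transition t s)). Qed.

(** As functions of [v], [Phi v u *m Phi u s] and [Phi v s] solve the same equation and agree at
    [v = u]; evaluating at [v = s] gives the identity. *)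
Lemma transition_inv (s u : R) : Phi s u *m Phi u s = 1%:M.
Proof.
rewrite -(proj1 tPhi s).
apply: (linear_ode_unique (V := V) (X := fun v => Phi v u *m Phi u s)
  (Y := fun v => Phi v s) (t := u) cV) => [v|v|].
- have := mx_is_derive_mul (mx_is_derive_transition v u) (mx_is_derive_const (Phi u s) v).
  by rewrite mulmx0 addr0 mulmxA.
- exact: mx_is_derive_transition.
- by rewrite (proj1 tPhi) mul1mx.
Qed.

(* [Phi s u] is the inverse of [Phi u s], so Cramer's rule gives differentiability in [u]. *)
Lemma mx_is_derive_transition_start (s u : R) :
  mx_is_derive (fun v => Phi s v) u (- (Phi s u *m V u)).
Proof.
have exY : mx_ex_derive (fun v => Phi s v) u.
  apply: (mx_ex_derive_inv (X := fun v => Phi v s)) => [v|i j].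
    exact: transition_inv.
  by eexists; exact: mx_is_derive_transition.
pose D : 'M[R]_n := \matrix_(i, j) Derive (fun v => Phi s v i j) u.
have dY : mx_is_derive (fun v => Phi s v) u D.
  by move=> i j; rewrite mxE; exact: Derive_correct.
suff -> : - (Phi s u *m V u) = D by [].
(* The derivative is identified by differentiating the constant product [Phi s v *m Phi v s] and
   multiplying on the right by [Phi s u]. *)
have dYX := mx_is_derive_mul dY (mx_is_derive_transition u s).
have d1 : mx_is_derive (fun v => Phi s v *m Phi v s) u 0.
  move=> i j; apply: (is_derive_ext (fun v => (1%:M : 'M[R]_n) i j)) => [v|].
    by rewrite transition_inv.
  exact: mx_is_derive_const.
have /eqP := mx_is_derive_unique dYX d1; rewrite mulmxA addr_eq0 => /eqP e.
by rewrite -[D]mulmx1 -(transition_inv u s) mulmxA e mulNmx -!mulmxA transition_inv mulmx1.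
Qed.

(** The two terms containing [V], one from each transition matrix, cancel and leave only the
    perturbation [K C]. *)
Lemma variation_of_constants (m : nat) (K : R -> 'M[R]_(n, m)) (C : R -> 'M[R]_(m, n))
    (Psi : R -> R -> 'M[R]_n) (xi x : 'cV[R]_n) (s tau u : R) :
  is_transition_matrix (fun t => V t - K t *m C t) Psi ->
  is_derive (fun u => dotv xi (Phi s u *m (Psi u tau *m x))) u
    (- dotv xi (Phi s u *m (K u *m (C u *m (Psi u tau *m x))))).
Proof.
move=> tPsi.
have dPsi : mx_is_derive (fun v => Psi v tau) u ((V u - K u *m C u) *m Psi u tau).
  by move=> i j; exact: (proj2 tPsi).
have dx := mx_is_derive_mul dPsi (mx_is_derive_const x u).
have dPx := mx_is_derive_mul (mx_is_derive_transition_start s u) dx.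
have := is_derive_dotv (mx_is_derive_const xi u) dPx.
have dot0 y : dotv (0 : 'cV[R]_n) y = 0 by rewrite /dotv trmx0 mul0mx mxE.
rewrite dot0 add0r mulmx0 addr0.
rewrite !mulmxBl mulmxBr !mulmxA !mulNmx addrA addNr add0r dotvNr.
exact: id.
Qed.

End Transition.

End LinearODE.

(** * Gramians as quadratic forms: reduction of the Loewner order to output energies *)

Section Gramians.

(** This is the quadratic form of [gramM] when [tau = a] and of [gramN] when [tau = b]. A base time
    independent of the window lets one estimate serve both. *)
Definition obs_energy (n m : nat) (Phi : R -> R -> 'M[R]_n) (C : R -> 'M[R]_(m, n))
    (tau a b : R) (x : 'cV[R]_n) : R :=
  RInt (fun s => dotv (C s *m (Phi s tau *m x)) (C s *m (Phi s tau *m x))) a b.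

Lemma is_RInt_sum (I : Type) (r : seq I) (F : I -> R -> R) (J : I -> R) (a b : R) :
  (forall i, is_RInt (F i) a b (J i)) ->
  is_RInt (fun u => \sum_(i <- r) F i u) a b (\sum_(i <- r) J i).
Proof.
move=> hF; elim: r => [|i r IHr].
  rewrite big_nil; apply: (is_RInt_ext (fun _ : R => 0 : R)) => [u _|]; first by rewrite big_nil.
  by have := is_RInt_const a b (0 : R); rewrite /scal /= /mult /= Rmult_0_r.
rewrite big_cons.
apply: (is_RInt_ext (fun u => F i u + \sum_(j <- r) F j u)) => [u _|].
  by rewrite big_cons.
exact: is_RInt_plus.
Qed.

Lemma quadratic_form_RInt (n : nat) (G : R -> 'M[R]_n) (a b : R) (x : 'cV[R]_n) :
  mx_continuous G ->
  (x^T *m (\matrix_(i, j) RInt (fun s => G s i j) a b) *m x) 0 0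
  = RInt (fun s => (x^T *m G s *m x) 0 0) a b.
Proof.
move=> cG; apply/esym/is_RInt_unique.
have quadE (M : 'M[R]_n) :
    (x^T *m M *m x) 0 0 = \sum_j \sum_i Rmult (Rmult (x i 0) (x j 0)) (M i j).
  rewrite mxE; apply: eq_bigr => j _; rewrite mxE mulr_suml.
  by apply: eq_bigr => i _; rewrite !mxE !RmultE mulrAC.
rewrite quadE; apply: (is_RInt_ext _ _ _ _ _ (fun u _ => esym (quadE (G u)))).
apply: is_RInt_sum => j; apply: is_RInt_sum => i; apply: is_RInt_scal.
rewrite mxE; apply: RInt_correct; apply: ex_RInt_continuous_everywhere => u.
exact: cG.
Qed.

Lemma loewner_leP (n : nat) (P Q : 'M[R]_n) :
  loewner_le P Q <-> forall x : 'cV[R]_n, Rle ((x^T *m P *m x) 0 0) ((x^T *m Q *m x) 0 0).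
Proof.
have e (x : 'cV[R]_n) : (0 <= (x^T *m (Q - P) *m x) 0 0)
    = ((x^T *m P *m x) 0 0 <= (x^T *m Q *m x) 0 0).
  by rewrite mulmxBr mulmxBl mxE [X in _ + X]mxE subr_ge0.
by split=> h x; [apply/RleP; rewrite -e | rewrite e; apply/RleP]; exact: h.
Qed.

Lemma scalar_quadratic_form (n : nat) (c : R) (x : 'cV[R]_n) :
  (x^T *m c%:M *m x) 0 0 = Rmult c (dotv x x).
Proof. by rewrite mul_mx_scalar -scalemxAl mxE. Qed.

Variables (n m : nat) (V : R -> 'M[R]_n) (Phi : R -> R -> 'M[R]_n) (C : R -> 'M[R]_(m, n)).
Hypotheses (tPhi : is_transition_matrix V Phi) (cC : mx_continuous C).

Lemma mx_continuous_output (tau : R) (x : 'cV[R]_n) :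
  mx_continuous (fun s => C s *m (Phi s tau *m x)).
Proof.
apply: mx_continuous_mul => //; apply: mx_continuous_mul; last exact: mx_continuous_const.
exact: (@mx_continuous_transition _ _ _ tPhi tau).
Qed.

(** The matrix is spelled out so that [gramM] and [gramN] both unfold to instances of it. *)
Lemma gram_quadratic_form (tau a b : R) (x : 'cV[R]_n) :
  (x^T *m (\matrix_(i, j)
      RInt (fun s => ((Phi s tau)^T *m (C s)^T *m C s *m Phi s tau) i j) a b) *m x) 0 0
  = obs_energy Phi C tau a b x.
Proof.
have cP : mx_continuous (fun s => Phi s tau) by exact: (@mx_continuous_transition _ _ _ tPhi tau).
rewrite (quadratic_form_RInt (G := fun s => (Phi s tau)^T *m (C s)^T *m C s *m Phi s tau)).
  by apply: RInt_ext => s _; rewrite /dotv !trmx_mul !mulmxA.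
apply: mx_continuous_mul => //; apply: mx_continuous_mul => //.
by apply: mx_continuous_mul; exact: mx_continuous_tr.
Qed.

Lemma loewner_le_gram_l (c tau a b : R) :
  loewner_le c%:M (\matrix_(i, j)
      RInt (fun s => ((Phi s tau)^T *m (C s)^T *m C s *m Phi s tau) i j) a b) <->
  forall x, Rle (Rmult c (dotv x x)) (obs_energy Phi C tau a b x).
Proof.
by rewrite loewner_leP; split=> h x; move: (h x);
  rewrite gram_quadratic_form scalar_quadratic_form.
Qed.

Lemma loewner_le_gram_r (c tau a b : R) :
  loewner_le (\matrix_(i, j)
      RInt (fun s => ((Phi s tau)^T *m (C s)^T *m C s *m Phi s tau) i j) a b) c%:M <->
  forall x, Rle (obs_energy Phi C tau a b x) (Rmult c (dotv x x)).
Proof.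
by rewrite loewner_leP; split=> h x; move: (h x);
  rewrite gram_quadratic_form scalar_quadratic_form.
Qed.

End Gramians.

(** * Comparison of the output energies of the two systems *)

Section Perturbation.
Local Open Scope R_scope.

(** Replaces an integral from [tau] to [s], in either order, by one over the whole window, which no
    longer depends on [s]. *)
Lemma abs_RInt_subinterval_le (q : R -> R) (a b t s : R) :
  (forall u, Continuity.continuous q u) -> (forall u, 0 <= q u) ->
  a <= t <= b -> a <= s <= b -> Rabs (RInt q t s) <= RInt q a b.
Proof.
move=> cq q0 [at_ tb] [as_ sb].
have ex u v : ex_RInt q u v by exact: ex_RInt_continuous_everywhere.
have ge0 u v : u <= v -> 0 <= RInt q u v by move=> uv; apply: RInt_ge_0.
have e1 : RInt q a t + RInt q t b = RInt q a b by apply: (RInt_Chasles q a t b).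
have e2 : RInt q a s + RInt q s b = RInt q a b by apply: (RInt_Chasles q a s b).
have e3 : RInt q a t + RInt q t s = RInt q a s by apply: (RInt_Chasles q a t s).
have := ge0 _ _ at_; have := ge0 _ _ tb; have := ge0 _ _ as_; have := ge0 _ _ sb.
by move=> *; apply: Rabs_le; lra.
Qed.

Variables (n m : nat) (V : R -> 'M[R]_n) (K : R -> 'M[R]_(n, m)) (C : R -> 'M[R]_(m, n)).
Variables (Phi Psi : R -> R -> 'M[R]_n).
Hypotheses (cV : mx_continuous V) (cC : mx_continuous C).
Hypotheses (tPhi : is_transition_matrix V Phi).
Hypotheses (tPsi : is_transition_matrix (fun t => V t - K t *m C t)%R Psi).

(** Variation of constants is integrated from [tau] to [s] with test vector [C(s)^T xi]; the
    integral is then enlarged to the window. *)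
Lemma output_diff_le (tau a b s D : R) (x : 'cV[R]_n) :
  a <= tau <= b -> a <= s <= b -> 0 <= D ->
  (forall u v, a <= u <= b ->
     vnorm (C s *m (Phi s u *m (K u *m v))) <= D * vnorm v) ->
  vnorm (C s *m (Phi s tau *m x)) <=
    vnorm (C s *m (Psi s tau *m x))
    + D * RInt (fun u => vnorm (C u *m (Psi u tau *m x))) a b.
Proof.
move=> htau hs D0 hD.
pose q u := vnorm (C u *m (Psi u tau *m x)).
have cq u : Continuity.continuous q u.
  by apply: continuous_vnorm; exact: (@mx_continuous_output _ _ _ _ _ tPsi cC tau x).
have q0 u : 0 <= q u by exact: vnorm_ge0.
have I0 : 0 <= RInt q a b.
  apply: RInt_ge_0 => //; first lra; exact: ex_RInt_continuous_everywhere.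
have -> : C s *m (Phi s tau *m x)
    = (C s *m (Psi s tau *m x) + (C s *m (Phi s tau *m x) - C s *m (Psi s tau *m x)))%R.
  by rewrite addrC subrK.
apply: Rle_trans (vnorm_triangle _ _) _; apply: Rplus_le_compat_l.
apply: vnorm_le_dual => [|xi]; first exact: Rmult_le_pos.
pose p u := dotv ((C s)^T *m xi) (Phi s u *m (Psi u tau *m x)).
(* At [u = s] the factor [Phi s s] is the identity, and at [u = tau] the factor [Psi tau tau] is, so
   the endpoints of [p] are the two outputs tested against [xi]. *)
have -> : dotv xi (C s *m (Phi s tau *m x) - C s *m (Psi s tau *m x))%R = - (p s - p tau).
  rewrite /p (proj1 tPhi) (proj1 tPsi) !mul1mx -!dotv_mulmx dotvBr; ring.
rewrite Rabs_Ropp.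
pose qx u := vnorm xi * D * q u.
have cqx u : Continuity.continuous qx u.
  by apply: continuous_mult; [exact: continuous_const | exact: cq].
have xi0 := vnorm_ge0 xi.
have qx0 u : 0 <= qx u by apply: Rmult_le_pos => //; exact: Rmult_le_pos.
have -> : vnorm xi * (D * RInt q a b) = RInt qx a b.
  rewrite -Rmult_assoc; apply/esym; apply: (RInt_scal q).
  exact: ex_RInt_continuous_everywhere.
apply: Rle_trans (abs_RInt_subinterval_le cqx qx0 htau hs).
apply: derive_abs_le_RInt cqx _ => [u|u hu].
  exact: (variation_of_constants cV tPhi _ _ _ _ _ tPsi).
rewrite Rabs_Ropp -dotv_mulmx; apply: Rle_trans (dotv_cauchy_schwarz _ _) _.
rewrite /qx Rmult_assoc; apply: Rmult_le_compat_l => //.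
apply: hD; move: hu; rewrite /Rmin /Rmax; case: Rle_dec; lra.
Qed.

(** With [S] the integral of the [Psi] output norm, the pointwise bound is squared by
    [(w + d)^2 <= 2 w^2 + 2 d^2] with [d = D * S] constant in time, and then integrated over the
    window. *)
Lemma obs_energy_comparison (tau a b D : R) (x : 'cV[R]_n) :
  a < b -> a <= tau <= b -> 0 <= D ->
  (forall s u v, a <= s <= b -> a <= u <= b ->
     vnorm (C s *m (Phi s u *m (K u *m v))) <= D * vnorm v) ->
  obs_energy Phi C tau a b x <=
    (2 + 2 * ((D * (b - a)) * (D * (b - a)))) * obs_energy Psi C tau a b x.
Proof.
move=> ab htau D0 hD.
pose z u := C u *m (Psi u tau *m x).
pose q u := vnorm (z u).
have cz : mx_continuous z by exact: (@mx_continuous_output _ _ _ _ _ tPsi cC tau x).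
have cy : mx_continuous (fun u => C u *m (Phi u tau *m x)).
  exact: (@mx_continuous_output _ _ _ _ _ tPhi cC tau x).
have cq u : Continuity.continuous q u by exact: continuous_vnorm.
pose S : R := RInt q a b.
pose J : R := obs_energy Psi C tau a b x.
have cs : S * S <= (b - a) * J.
  have <- : RInt (fun u => q u * q u) a b = J by apply: RInt_ext => u _; exact: vnorm_sqr.
  exact: RInt_cauchy_schwarz.
have S0 : 0 <= S.
  apply: RInt_ge_0 => //; [lra | exact: ex_RInt_continuous_everywhere |].
  by move=> u _; exact: vnorm_ge0.
have hI : is_RInt (fun u => 2 * dotv (z u) (z u) + 2 * (D * S * (D * S))) a b
            (2 * J + (b - a) * (2 * (D * S * (D * S)))).
  apply: is_RInt_plus; last exact: is_RInt_const.
  apply: is_RInt_scal; apply: RInt_correct; apply: ex_RInt_continuous_everywhere => u.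
  exact: continuous_dotv.
have h1 : obs_energy Phi C tau a b x <= 2 * J + (b - a) * (2 * (D * S * (D * S))).
  rewrite -(is_RInt_unique _ _ _ _ hI); apply: RInt_le; first lra.
  - by apply: ex_RInt_continuous_everywhere => u; exact: continuous_dotv.
  - by eexists; exact: hI.
  move=> u hu.
  have := @output_diff_le tau a b u D x htau _ D0; rewrite -/(z u) -/q -/S -!vnorm_sqr.
  have hu' : a <= u <= b by lra.
  move=> /(_ hu' (fun w v hw => hD u w v hu' hw)).
  rewrite -/(q u); have := vnorm_ge0 (C u *m (Phi u tau *m x)); have : 0 <= q u by exact: vnorm_ge0.
  set y := vnorm _; set w := q u; set d := D * S => w0 y0 hy.
  have h2 : y * y <= (w + d) * (w + d) by apply: Rmult_le_compat.
  have := Rle_0_sqr (w - d); rewrite /Rsqr; lra.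
apply: Rle_trans h1 _; rewrite -/J.
(* Cauchy-Schwarz turns the contribution of the constant [D * S] into a multiple of the energy
   [J]. *)
have h3 : D * D * (b - a) * (S * S) <= D * D * (b - a) * ((b - a) * J).
  apply: Rmult_le_compat_l => //; apply: Rmult_le_pos; [exact: Rle_0_sqr | lra].
lra.
Qed.

End Perturbation.

(** * Quantitative estimates under non-uniform bounded growth *)

Section BoundedGrowth.
Local Open Scope R_scope.

Lemma exp_le (x y : R) : x <= y -> exp x <= exp y.
Proof. by case=> [lt_xy|->]; [left; exact: exp_increasing | right]. Qed.

Lemma Rabs_interval_le (t sigma s : R) :
  t <= s <= t + sigma -> Rabs s <= Rabs t + sigma.
Proof. by rewrite /Rabs; do 2 case: Rcase_abs; lra. Qed.

Lemma Rabs_diff_interval_le (t sigma s u : R) :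
  t <= s <= t + sigma -> t <= u <= t + sigma -> Rabs (s - u) <= sigma.
Proof. by move=> *; apply: Rabs_le; lra. Qed.

Variables (n m : nat) (V : R -> 'M[R]_n) (K : R -> 'M[R]_(n, m)) (C : R -> 'M[R]_(m, n)).
Variables (Phi Psi : R -> R -> 'M[R]_n).
Variables (K0 a eps calK calC delta gamma : R).
Hypotheses (cV : mx_continuous V) (cC : mx_continuous C).
Hypotheses (tPhi : is_transition_matrix V Phi).
Hypotheses (tPsi : is_transition_matrix (fun t => V t - K t *m C t)%R Psi).
Hypotheses (K00 : 0 < K0) (a0 : 0 < a) (eps0 : 0 < eps).
Hypotheses (calK0 : 0 < calK) (calC0 : 0 < calC) (gamma0 : 0 <= gamma).
Hypothesis ltd : gamma + eps < delta.
Hypothesis gPhi : nonuniform_bounded_growth Phi K0 a eps.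
Hypothesis bK : forall z, opnorm_le (K z) (calK * exp (- (delta * Rabs z)))%R.
Hypothesis bC : forall z, opnorm_le (C z) (calC * exp (gamma * Rabs z))%R.

Lemma vnorm_transition_le (t tau : R) (x : 'cV[R]_n) :
  vnorm (Phi t tau *m x)
    <= K0 * exp (eps * Rabs tau) * exp (a * Rabs (t - tau)) * vnorm x.
Proof. by apply/RleP; exact: gPhi. Qed.

Lemma vnorm_output_le (z : R) (x : 'cV[R]_n) :
  vnorm (C z *m x) <= calC * exp (gamma * Rabs z) * vnorm x.
Proof. by apply/RleP; exact: bC. Qed.

Lemma vnorm_gain_le (z : R) (y : 'cV[R]_m) :
  vnorm (K z *m y) <= calK * exp (- (delta * Rabs z)) * vnorm y.
Proof. by apply/RleP; exact: bK. Qed.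

(** The gap [gamma + eps < delta] lets the decay of [K] absorb the factor [exp (eps |u|)] and still
    leave [exp (- gamma |u|)], enough to offset the growth of [C] at time [u]. *)
Lemma vnorm_transition_gain_le (s u : R) (y : 'cV[R]_m) :
  vnorm (Phi s u *m (K u *m y))
    <= K0 * calK * exp (a * Rabs (s - u)) * exp (- (gamma * Rabs u)) * vnorm y.
Proof.
apply: Rle_trans (vnorm_transition_le _ _ _) _.
have y0 := vnorm_ge0 y; have e1 := exp_pos (eps * Rabs u).
have e2 := exp_pos (a * Rabs (s - u)).
apply: Rle_trans (Rmult_le_compat_l _ _ _ _ (vnorm_gain_le u y)) _.
  by apply: Rmult_le_pos; [apply: Rmult_le_pos|]; lra.
have h : exp (eps * Rabs u) * exp (- (delta * Rabs u)) <= exp (- (gamma * Rabs u)).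
  rewrite -exp_plus; apply: exp_le; have := Rabs_pos u; nra.
have c0 : 0 <= K0 * calK * exp (a * Rabs (s - u)) * vnorm y.
  by repeat apply: Rmult_le_pos; lra.
have := Rmult_le_compat_l _ _ _ c0 h; lra.
Qed.

(* Gronwall for [exp (- a |s - tau|) * |Psi s tau x|]; only the exponent [a] deteriorates. *)
Lemma perturbed_growth :
  nonuniform_bounded_growth Psi K0 (a + K0 * calK * calC) eps.
Proof.
move=> s0 tau x; apply/RleP.
pose w u := vnorm (Psi u tau *m x).
pose h u := exp (- (a * Rabs (u - tau))) * w u.
pose c := K0 * calK * calC.
pose B := K0 * exp (eps * Rabs tau) * vnorm x.
have c0 : 0 <= c by repeat apply: Rmult_le_pos; lra.
have w0 u : 0 <= w u by exact: vnorm_ge0.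
have h0 u : 0 <= h u by apply: Rmult_le_pos => //; left; exact: exp_pos.
have ch u : Continuity.continuous h u.
  apply: continuous_mult.
    apply: continuous_comp; last exact: continuous_exp.
    apply: continuous_opp; apply: continuous_mult; first exact: continuous_const.
    apply: continuous_comp; last exact: continuous_Rabs.
    by apply: continuous_minus; [exact: continuous_id | exact: continuous_const].
  apply: continuous_vnorm; apply: mx_continuous_mul; last exact: mx_continuous_const.
  exact: (@mx_continuous_transition _ _ _ tPsi tau).
have wh u : w u = exp (a * Rabs (u - tau)) * h u.
  by rewrite /h -Rmult_assoc -exp_plus Rplus_opp_r exp_0 Rmult_1_l.
have key s : h s <= B + c * Rabs (RInt h tau s).
  set I := Rabs (RInt h tau s).
  have I0 : 0 <= I by exact: Rabs_pos.
  set E := exp (a * Rabs (s - tau)).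
  have E0 : 0 < E by exact: exp_pos.
  have cEI0 : 0 <= c * E * I by repeat apply: Rmult_le_pos; lra.
  (* Variation of constants again, now for the states instead of the outputs. *)
  have diff : vnorm (Psi s tau *m x - Phi s tau *m x)%R <= c * E * I.
    apply: vnorm_le_dual => // xi.
    pose p u := dotv xi (Phi s u *m (Psi u tau *m x)).
    have -> : dotv xi (Psi s tau *m x - Phi s tau *m x)%R = p s - p tau.
      by rewrite /p (proj1 tPhi) (proj1 tPsi) !mul1mx dotvBr.
    pose q u := vnorm xi * (c * E) * h u.
    have cq u : Continuity.continuous q u.
      by apply: continuous_mult; [exact: continuous_const | exact: ch].
    have xi0 := vnorm_ge0 xi.
    have -> : vnorm xi * (c * E * I) = Rabs (RInt q tau s).
      have -> : RInt q tau s = vnorm xi * (c * E) * RInt h tau s.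
        by apply: (RInt_scal h); exact: ex_RInt_continuous_everywhere.
      rewrite Rabs_mult (Rabs_pos_eq (vnorm xi * (c * E))); first by rewrite /I; ring.
      by repeat apply: Rmult_le_pos; lra.
    apply: derive_abs_le_RInt cq _ => [u|u hu].
      exact: (variation_of_constants cV tPhi _ _ _ _ _ tPsi).
    rewrite Rabs_Ropp; apply: Rle_trans (dotv_cauchy_schwarz _ _) _.
    rewrite /q Rmult_assoc; apply: Rmult_le_compat_l => //.
    apply: Rle_trans (vnorm_transition_gain_le _ _ _) _.
    have g0 := exp_pos (- (gamma * Rabs u)); have e0 := exp_pos (a * Rabs (s - u)).
    apply: Rle_trans (Rmult_le_compat_l _ _ _ _ (vnorm_output_le u _)) _.
      by repeat apply: Rmult_le_pos; lra.
    (* The decay left over by the gain cancels the growth of [C], so the Gronwall rate [c] is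
       independent of time. *)
    have eg : exp (- (gamma * Rabs u)) * exp (gamma * Rabs u) = 1.
      by rewrite -exp_plus Rplus_opp_l exp_0.
    (* Since [u] lies between [tau] and [s], [|s - tau| = |s - u| + |u - tau|], and the weight in
       [h] splits off exactly. *)
    rewrite (Rmult_assoc c); have -> : E * h u = exp (a * Rabs (s - u)) * w u.
      rewrite /E /h -Rmult_assoc -exp_plus; congr (exp _ * _).
      have -> : Rabs (s - tau) = Rabs (s - u) + Rabs (u - tau); last by ring.
      by move: hu; rewrite /Rmin /Rmax /Rabs; case: Rle_dec; do 3 case: Rcase_abs; lra.
    rewrite -/(w u); right.
    transitivity (c * (exp (a * Rabs (s - u)) * w u)
                  * (exp (- (gamma * Rabs u)) * exp (gamma * Rabs u))); first by rewrite /c; ring.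
    by rewrite eg; ring.
  have ws : w s <= E * B + c * E * I.
    rewrite /w -[Psi s tau *m x](subrK (Phi s tau *m x)).
    apply: Rle_trans (vnorm_triangle _ _) _.
    apply: Rle_trans (Rplus_le_compat _ _ _ _ diff (vnorm_transition_le s tau x)) _.
    by rewrite -/E /B; right; ring.
  have hE : E * h s <= E * (B + c * I) by rewrite -wh; lra.
  exact: Rmult_le_reg_l E0 hE.
have := gronwall h B c tau c0 ch h0 key s0; rewrite -/(w s0) wh.
(* Removing the weight adds the exponents [a] and [c]. *)
move=> /(Rmult_le_compat_l (exp (a * Rabs (s0 - tau)))) => /(_ (Rlt_le _ _ (exp_pos _))).
have -> : exp (a * Rabs (s0 - tau)) * (B * exp (c * Rabs (s0 - tau)))
   = K0 * exp (eps * Rabs tau) * exp ((a + c) * Rabs (s0 - tau)) * vnorm x.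
  by rewrite Rmult_plus_distr_r exp_plus /B; ring.
exact: id.
Qed.

(** On the window both [|s|] and [|tau|] are at most [|t| + sigma], which bounds the output by
    [W * vnorm x] uniformly. The factor [1 + sigma] dominates the window length and stays positive
    at [sigma = 0], as [NUCO] demands of its functions. *)
Lemma obs_energy_upper (tau t sigma : R) (x : 'cV[R]_n) :
  0 < sigma -> t <= tau <= t + sigma ->
  obs_energy Phi C tau t (t + sigma) x <=
    exp (2 * (gamma + eps) * Rabs t)
    * ((1 + sigma) * Rsqr (calC * exp (gamma * sigma)
                           * (K0 * exp (eps * sigma) * exp (a * sigma)))) * dotv x x.
Proof.
move=> sigma0 htau.
set U := calC * _ * _.
pose W := exp ((gamma + eps) * Rabs t) * U.
have U0 : 0 < U.
  by rewrite /U; repeat apply: Rmult_lt_0_compat => //; exact: exp_pos.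
have W0 : 0 < W by apply: Rmult_lt_0_compat => //; exact: exp_pos.
have bound s : t <= s <= t + sigma -> vnorm (C s *m (Phi s tau *m x)) <= W * vnorm x.
  move=> hs; have x0 := vnorm_ge0 x.
  have hs1 := Rabs_interval_le hs; have htau1 := Rabs_interval_le htau.
  have hst := Rabs_diff_interval_le hs htau.
  have -> : W * vnorm x = calC * exp (gamma * (Rabs t + sigma))
      * (K0 * exp (eps * (Rabs t + sigma)) * exp (a * sigma) * vnorm x).
    by rewrite /W /U !Rmult_plus_distr_l Rmult_plus_distr_r !exp_plus; ring.
  apply: Rle_trans (vnorm_output_le _ _) _.
  apply: Rmult_le_compat; [|exact: vnorm_ge0| |].
  - by apply: Rmult_le_pos; [lra | left; exact: exp_pos].
  - by apply: Rmult_le_compat_l; [lra | apply: exp_le; exact: Rmult_le_compat_l].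
  apply: Rle_trans (vnorm_transition_le _ _ _) _.
  apply: Rmult_le_compat_r => //; apply: Rmult_le_compat.
  - by apply: Rmult_le_pos; [lra | left; exact: exp_pos].
  - by left; exact: exp_pos.
  - by apply: Rmult_le_compat_l; [lra | apply: exp_le; apply: Rmult_le_compat_l; lra].
  - by apply: exp_le; apply: Rmult_le_compat_l; lra.
have cy := @mx_continuous_output _ _ _ _ _ tPhi cC tau x.
have hI := is_RInt_const t (t + sigma) (W * vnorm x * (W * vnorm x)).
apply: Rle_trans (_ : sigma * (W * vnorm x * (W * vnorm x)) <= _).
  have e : RInt (fun=> W * vnorm x * (W * vnorm x)) t (t + sigma)
      = sigma * (W * vnorm x * (W * vnorm x)).
    rewrite (is_RInt_unique _ _ _ _ hI) /scal /= /mult /=; ring.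
  rewrite -e; apply: RInt_le; first lra.
  - by apply: ex_RInt_continuous_everywhere => u; exact: continuous_dotv.
  - by eexists; exact: hI.
  move=> s hs; rewrite -vnorm_sqr.
  have h : vnorm (C s *m (Phi s tau *m x)) <= W * vnorm x by apply: bound; lra.
  by apply: Rmult_le_compat => //; exact: vnorm_ge0.
rewrite -vnorm_sqr /W /Rsqr.
have -> : 2 * (gamma + eps) * Rabs t = (gamma + eps) * Rabs t + (gamma + eps) * Rabs t by ring.
rewrite exp_plus; set e := exp _.
have : 0 <= (e * U * vnorm x) * (e * U * vnorm x) by exact: Rle_0_sqr.
lra.
Qed.

(** The constant of [obs_energy_comparison] with [exp (gamma |t|)] stripped from [D], so that it
    depends on [sigma] alone. *)
Definition comparison_factor (sigma : R) : R :=
  2 + 2 * Rsqr (calC * exp (gamma * sigma) * (K0 * calK * exp (a * sigma)) * sigma).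

Lemma comparison_factor_gt0 (sigma : R) : 0 < comparison_factor sigma.
Proof.
rewrite /comparison_factor.
have := Rle_0_sqr (calC * exp (gamma * sigma) * (K0 * calK * exp (a * sigma)) * sigma); lra.
Qed.

(** The comparison holds with [D = g * d], where [g = exp (gamma |t|)] carries all dependence on
    [t]. Dividing by [g^2] raises the exponent from [nu] to [nu + gamma]. *)
Lemma obs_energy_lower (tau t sigma nu theta : R) (x : 'cV[R]_n) :
  0 < sigma -> t <= tau <= t + sigma ->
  exp (- (2 * nu * Rabs t)) * theta * dotv x x <= obs_energy Phi C tau t (t + sigma) x ->
  exp (- (2 * (nu + gamma) * Rabs t)) * (theta / comparison_factor sigma) * dotv x x
    <= obs_energy Psi C tau t (t + sigma) x.
Proof.
move=> sigma0 htau low.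
set g := exp (gamma * Rabs t).
have g1 : 1 <= g.
  rewrite -exp_0; apply: exp_le; apply: Rmult_le_pos => //; exact: Rabs_pos.
set d := calC * exp (gamma * sigma) * (K0 * calK * exp (a * sigma)).
have d0 : 0 < d.
  by rewrite /d; repeat apply: Rmult_lt_0_compat => //; exact: exp_pos.
have gd0 : 0 <= g * d by apply: Rmult_le_pos; lra.
have hD s u v : t <= s <= t + sigma -> t <= u <= t + sigma ->
    vnorm (C s *m (Phi s u *m (K u *m v))) <= g * d * vnorm v.
  move=> hs hu; have v0 := vnorm_ge0 v.
  have -> : g * d * vnorm v = calC * exp (gamma * (Rabs t + sigma))
      * (K0 * calK * exp (a * sigma) * 1 * vnorm v).
    by rewrite /g /d Rmult_plus_distr_l exp_plus; ring.
  apply: Rle_trans (vnorm_output_le _ _) _.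
  apply: Rmult_le_compat; [|exact: vnorm_ge0| |].
  - by apply: Rmult_le_pos; [lra | left; exact: exp_pos].
  - apply: Rmult_le_compat_l; [lra | apply: exp_le; apply: Rmult_le_compat_l => //].
    exact: Rabs_interval_le.
  apply: Rle_trans (vnorm_transition_gain_le _ _ _) _.
  apply: Rmult_le_compat_r => //.
  have KK : 0 < K0 * calK by exact: Rmult_lt_0_compat.
  apply: Rmult_le_compat.
  - by apply: Rmult_le_pos; [lra | left; exact: exp_pos].
  - by left; exact: exp_pos.
  - apply: Rmult_le_compat_l; [lra | apply: exp_le; apply: Rmult_le_compat_l; first lra].
    exact: Rabs_diff_interval_le hs hu.
  (* The remaining decay [exp (- gamma |u|)] is simply bounded by 1. *)
  - rewrite -exp_0; apply: exp_le.
    have : 0 <= gamma * Rabs u by apply: Rmult_le_pos => //; exact: Rabs_pos.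
    lra.
have ab : t < t + sigma by lra.
have := obs_energy_comparison cV cC tPhi tPsi x ab htau gd0 hD.
have J0 : 0 <= obs_energy Psi C tau t (t + sigma) x.
  apply: RInt_ge_0; first lra.
    apply: ex_RInt_continuous_everywhere => u; apply: continuous_dotv;
      exact: (@mx_continuous_output _ _ _ _ _ tPsi cC tau x).
  by move=> u _; exact: dotv_ge0.
set J := obs_energy Psi C tau t (t + sigma) x in J0 *.
have -> : t + sigma - t = sigma by ring.
move=> hcmp.
have F0 := comparison_factor_gt0 sigma; set F := comparison_factor sigma in F0 *.
(* Because [g >= 1], the constant term 2 is absorbed into [2 g^2]. *)
have hF : 2 + 2 * (g * d * sigma * (g * d * sigma)) <= g * g * F.
  have -> : F = 2 + 2 * (d * sigma * (d * sigma)) by [].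
  nra.
have hJ : exp (- (2 * nu * Rabs t)) * theta * dotv x x <= g * g * F * J.
  apply: Rle_trans low (Rle_trans _ _ _ hcmp _); exact: Rmult_le_compat_r.
have -> : - (2 * (nu + gamma) * Rabs t)
    = - (2 * nu * Rabs t) + (- (gamma * Rabs t) + - (gamma * Rabs t)) by ring.
rewrite !exp_plus (exp_Ropp (gamma * Rabs t)) -/g.
have gF0 : 0 < g * g * F by apply: Rmult_lt_0_compat => //; nra.
apply: (Rmult_le_reg_l (g * g * F)) => //.
apply: Rle_trans hJ; right; field; lra.
Qed.

End BoundedGrowth.

(** * Transfer of observability between the two systems and the equivalence *)

(** Lower bounds come from those of [Phi] by energy comparison, upper bounds from the growth of
    [Psi]. Assuming growth of both systems, with separate rates [a] and [a'], makes the statement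
    usable in both directions. *)
Lemma NUCO_perturbed (n m : nat) (V : R -> 'M[R]_n) (K : R -> 'M[R]_(n, m))
    (C : R -> 'M[R]_(m, n)) (Phi Psi : R -> R -> 'M[R]_n)
    (K0 a a' eps calK calC delta gamma : R) :
  mx_continuous V -> mx_continuous C ->
  is_transition_matrix V Phi -> is_transition_matrix (fun t => V t - K t *m C t) Psi ->
  0 < K0 -> 0 < a -> 0 < a' -> 0 < eps -> 0 < calK -> 0 < calC -> 0 <= gamma ->
  gamma + eps < delta ->
  nonuniform_bounded_growth Phi K0 a eps -> nonuniform_bounded_growth Psi K0 a' eps ->
  (forall z, opnorm_le (K z) (calK * exp (- (delta * Rabs z)))) ->
  (forall z, opnorm_le (C z) (calC * exp (gamma * Rabs z))) ->
  NUCO Phi C -> NUCO Psi C.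
Proof.
move=> cV cC tPhi tPsi /RltP K00 /RltP a0 /RltP a'0 /RltP eps0 /RltP calK0 /RltP calC0.
move=> /RleP gamma0 /RltP ltd gPhi gPsi bK bC.
case=> nu0 [nu1 [bnu0 [bnu1 [nu0_ge0 [_ [bnu0_ge0 [_]]]]]]].
case=> theta0 [rho0 [theta1 [rho1 [pos hN]]]].
have gamma_ge0 : 0 <= gamma by apply/RleP.
have eps_ge0 : 0 <= eps by apply/ltW/RltP.
(* The lower exponents gain [gamma] from [obs_energy_lower]; the upper ones are those of
   [obs_energy_upper]. *)
exists (nu0 + gamma), (gamma + eps), (bnu0 + gamma), (gamma + eps).
do 4 (split; first by rewrite ?addr_ge0).
pose F := comparison_factor K0 a calK calC gamma.
pose U sigma : R := Rmult (Rplus 1 sigma) (Rsqr (Rmult (Rmult calC (exp (Rmult gamma sigma)))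
   (Rmult (Rmult K0 (exp (Rmult eps sigma))) (exp (Rmult a' sigma))))).
exists (fun s => Rdiv (theta0 s) (F s)), (fun s => Rdiv (rho0 s) (F s)), U, U.
have F0 s : Rlt 0 (F s) by exact: comparison_factor_gt0.
split=> [s s0|t].
  have U0 : 0 < U s.
    apply/RltP; apply: Rmult_lt_0_compat; first by have : Rle 0 s by [apply/RleP]; lra.
    by apply: Rlt_0_sqr; apply: Rgt_not_eq;
      repeat apply: Rmult_lt_0_compat => //; exact: exp_pos.
  have [/RltP th0 [/RltP rh0 _]] := pos s s0.
  by do !split=> //; apply/RltP; exact: Rdiv_lt_0_compat.
have [sigma0 [sigma00 hs]] := hN t; exists sigma0; split=> // sigma le_sigma.
have sigma_gt0 : Rlt 0 sigma by apply/RltP; exact: lt_le_trans le_sigma.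
have [lM [_ [lN _]]] := hs sigma le_sigma.
(* The base time is the left endpoint for [gramM] and the right endpoint for [gramN]. *)
have ht : Rle t t /\ Rle t (Rplus t sigma) by lra.
have ht' : Rle t (Rplus t sigma) /\ Rle (Rplus t sigma) (Rplus t sigma) by lra.
split; [|split; [|split]].
- apply/(loewner_le_gram_l tPsi cC) => x.
  move/(loewner_le_gram_l tPhi cC)/(_ x): lM => lM.
  exact: (obs_energy_lower cV cC tPhi tPsi K00 a0 calK0 calC0 gamma0 ltd gPhi bK bC
    sigma_gt0 ht (nu := nu0) lM).
- apply/(loewner_le_gram_r tPsi cC) => x.
  by apply: (obs_energy_upper cC tPsi K00 a'0 eps0 calC0 gamma0 gPsi bC).
- apply/(loewner_le_gram_l tPsi cC) => x.
  move/(loewner_le_gram_l tPhi cC)/(_ x): lN => lN.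
  exact: (obs_energy_lower cV cC tPhi tPsi K00 a0 calK0 calC0 gamma0 ltd gPhi bK bC
    sigma_gt0 ht' (nu := bnu0) lN).
- apply/(loewner_le_gram_r tPsi cC) => x.
  by apply: (obs_energy_upper cC tPsi K00 a'0 eps0 calC0 gamma0 gPsi bC).
Qed.

Theorem mainTheorem3 (n m : nat)
  (A : R -> 'M[R]_n) (K : R -> 'M[R]_(n, m)) (C : R -> 'M[R]_(m, n))
  (PhiA PhiAKC : R -> R -> 'M[R]_n)
  (K0 a eps calK calC delta gamma : R) :
  mx_continuous A -> mx_continuous K -> mx_continuous C ->
  is_transition_matrix A PhiA ->
  is_transition_matrix (fun t => A t - K t *m C t) PhiAKC ->
  0 < K0 -> 0 < a -> 0 < eps ->
  nonuniform_bounded_growth PhiA K0 a eps ->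
  0 < calK -> 0 < calC -> 0 < delta -> 0 <= gamma ->
  (forall z : R, opnorm_le (K z) (calK * exp (- (delta * Rabs z)))) ->
  (forall z : R, opnorm_le (C z) (calC * exp (gamma * Rabs z))) ->
  gamma + eps < delta ->
  (NUCO PhiA C <-> NUCO PhiAKC C).
Proof.
move=> cA cK cC tA tAKC K00 a0 eps0 gA calK0 calC0 _ gamma0 bK bC ltd.
have gAKC : nonuniform_bounded_growth PhiAKC K0 (a + K0 * calK * calC) eps.
  by apply: (perturbed_growth cA tA tAKC _ _ _ _ gA bK bC); apply/RltP.
have a'0 : 0 < a + K0 * calK * calC by rewrite addr_gt0 // !mulr_gt0.
split.
  exact: (NUCO_perturbed cA cC tA tAKC K00 a0 a'0 eps0 calK0 calC0 gamma0 ltd gA gAKC bK bC).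
(* The converse views [A] as the perturbation of [A - K C] by the gain [- K], which has the same
   norm bound; the growth rates exchange roles. *)
apply: (NUCO_perturbed (K := fun t => - K t) _ cC tAKC _ K00 a'0 a0 eps0 calK0 calC0 gamma0 ltd
  gAKC gA _ bC).
- exact: mx_continuous_sub cA (mx_continuous_mul cK cC).
- case: tA => A1 dA; split=> // t s i j.
  by rewrite mulNmx opprK subrK; exact: dA.
- move=> z x; rewrite mulNmx; have -> : vnorm (- (K z *m x)) = vnorm (K z *m x); last exact: bK.
  by rewrite /vnorm; congr (sqrt _); apply: eq_bigr => i _; rewrite mxE sqrrN.
Qed.
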